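(* Let $d,K\ge1$ be integers, $\varepsilon\in(0,1/2)$, $\gamma\in(1/\mathrm{poly}(d),1)$, and $p\in[1,2]$. Let $\mathcal{B}_2^d(1/d^{1/p-1/2})$ be the Euclidean ball in $\mathbb{R}^d$ centered at the origin with radius $d^{-(1/p-1/2)}$. Then, for any local oracle, $$\mathrm{Compl}_{\mathrm{HP}}^{\gamma}\big(\mathcal{F}^{0}_{\ell_p^d}(1),\ \mathcal{B}_2^d(1/d^{1/p-1/2}),\ K,\ \varepsilon\big)\geq M,$$ where $M$ is (implicitly) defined by $$M:=\min\Big\{\frac{1}{200\,\varepsilon^2},\ \frac{\varepsilon\, d^{1/2}}{32\sqrt{\ln(MK/\gamma)}}\Big\}.$$
   Context: Notation. $\ell_p^d=(\mathbb{R}^d,\|\cdot\|_p)$, with dual norm $\|\cdot\|_{p^*}$, $p^*=p/(p-1)$ ($p^*=\infty$ if $p=1$). $1/\mathrm{poly}(d)$ stands for the reciprocal of an (unspecified) polynomial in $d$. Function class. $\mathcal{F}^{0}_{\ell_p^d}(\mu)$ is the class of convex functions $f:\mathbb{R}^d\to\mathbb{R}$ with $\|g_x-g_y\|_{p^*}\le\mu$ for all $x,y\in\mathbb{R}^d$ and all subgradients $g_x\in\partial f(x)$, $g_y\in\partial f(y)$. Oracle model. For a class $\mathcal{F}$ of convex functions on $\mathbb{R}^d$ and a feasible set $\mathcal{X}$, an $\varepsilon$-solution for $f\in\mathcal{F}$ is an $x\in\mathcal{X}$ with $f(x)-\inf_{\mathcal{X}}f\le\varepsilon$. An oracle $\mathcal{O}$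 returns an answer $\mathcal{O}_f(x)$ for each $f\in\mathcal{F}$, $x\in\mathcal{X}$; it is local if $\mathcal{O}_f(x)=\mathcal{O}_g(x)$ whenever $f\equiv g$ in a neighborhood of $x$. A $K$-parallel deterministic algorithm works in rounds; in round $t$ it queries a batch $X^t=\{x_1^t,\ldots,x_K^t\}\subseteq\mathcal{X}$ and receives $\mathcal{O}_f(X^t)=(\mathcal{O}_f(x^t_1),\ldots,\mathcal{O}_f(x^t_K))$, where $X^1$ is fixed in advance and $X^{t+1}=U^{t+1}(X^1,\mathcal{O}_f(X^1),\ldots,X^t,\mathcal{O}_f(X^t))$ for deterministic functions $U^{t+1}$. $\mathcal{A}^K(\mathcal{O})$ is the set of such algorithms, and $T(A,f,\varepsilon)$ is the minimum number of rounds for algorithm $A$ run on $f$ to find (query) an $\varepsilon$-solution. With $\Delta(\mathcal{F})$ the set of probability distributions over $\mathcal{F}$, for $\gamma\in(0,1)$, $$\mathrm{Compl}_{\mathrm{HP}}^{\gamma}(\mathcal{F},\mathcal{X},K,\varepsilon)=\sup_{F\in\Delta(\mathcal{F})}\ \inf_{A\in\mathcal{A}^K(\mathcal{O})}\ \inf\{\tau:\ \mathbb{P}_{f\sim F}[T(A,f,\varepsilon)\le\tau]\ge\gamma\}.$$ *)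

(* Defs.v *)
From HB Require Import structures.
From mathcomp Require Import all_boot all_order all_algebra.
From mathcomp Require Import all_classical all_reals all_analysis.

Set Implicit Arguments.
Unset Strict Implicit.
Unset Printing Implicit Defensive.

Import Order.TTheory GRing.Theory Num.Theory.
Import numFieldNormedType.Exports.

Local Open Scope classical_set_scope.
Local Open Scope ring_scope.

Section lp_spaces.
Context {R : realType} {d : nat}.
Implicit Types (x y g : 'rV[R]_d) (f : 'rV[R]_d -> R).

(* The value at -oo is irrelevant. *)
Definition lpnorm (p : \bar R) x : R :=
  match p with
  | q%:E => (\sum_i `|x ord0 i| `^ q) `^ q^-1
  | +oo%E => \big[Num.max/0]_i `|x ord0 i|
  | -oo%E => 0
  end.

Definition dot x y : R := \sum_i x ord0 i * y ord0 i.

Definition subdifferential f x : set 'rV[R]_d :=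
  [set g | forall y, f x + dot g (y - x) <= f y].

Definition nonsmooth_class (p mu : R) : set ('rV[R]_d -> R) :=
  [set f | convex_function [set: convex_lmodType 'rV[R]_d] f /\
    forall x y gx gy, subdifferential f x gx -> subdifferential f y gy ->
      lpnorm (hoelder_conjugate p%:E) (gx - gy) <= mu].

Definition euclidean_ball (r : R) : set 'rV[R]_d :=
  [set x | lpnorm 2%:E x <= r].

End lp_spaces.

Section oracle_model.
Context {R : realType} {d : nat}.
Local Notation V := 'rV[R]_d.
Variables (F : set (V -> R)) (X : set V).
Variables (Ans : Type) (O : (V -> R) -> V -> Ans).
Variables (K : nat) (eps : R).

Definition eps_solution (f : V -> R) : set V :=
  [set x | X x /\
    ((f x)%:E - ereal_inf [set (f z)%:E | z in X] <= eps%:E)%E].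

(* The oracle is a total function, but its answers matter only on F x X.      *)
(* The neighborhood is a neighborhood in the whole space, not relative to X.  *)
Definition local_oracle : Prop :=
  forall f g x, F f -> F g -> X x ->
    (\forall y \near x, f y = g y) -> O f x = O g x.

(* A history lists, in chronological order, each batch with its answers;      *)
(* next_batch [::] is the batch X^1 that is fixed in advance, and             *)
(* next_batch restricted to histories of length t is U^{t+1}.                 *)
Record parallel_algorithm := ParallelAlgorithm {
  next_batch : seq (('I_K -> V) * ('I_K -> Ans)) -> 'I_K -> V ;
  next_batch_feasible : forall h k, X (next_batch h k)
}.

Fixpoint transcript (A : parallel_algorithm) (f : V -> R) (t : nat) :
    seq (('I_K -> V) * ('I_K -> Ans)) :=
  if t is t'.+1 then
    let h := transcript A f t' in
    let B := next_batch A h in rcons h (B, fun k => O f (B k))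
  else [::].

(* The batch of round t.+1. *)
Definition batch (A : parallel_algorithm) (f : V -> R) (t : nat) : 'I_K -> V :=
  next_batch A (transcript A f t).

(* Rounds are numbered from 1; the value is +oo if no round succeeds. *)
Definition rounds (A : parallel_algorithm) (f : V -> R) : \bar R :=
  ereal_inf [set (t.+1%:R)%:E | t in
    [set t : nat | exists k, eps_solution f (batch A f t k)]].

Definition evaluation_cylinders : set (set (V -> R)) :=
  \bigcup_(x in [set: V])
    preimage_set_system [set: V -> R] (fun f => f x) measurable.

Definition function_space := g_sigma_algebraType evaluation_cylinders.

(* Probability distributions over F: F need not be measurable in the          *)
(* function space, so "supported on F" means outer measure 1; these are the   *)
(* probability measures on the trace on F of the above sigma-algebra.         *)
Definition distributions : set (probability function_space R) :=
  [set P | mu_ext P (F : set function_space) = 1%E].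

(* Algorithms and oracles are arbitrary functions, so this event need not be  *)
(* measurable; its probability is read as its outer probability, which is     *)
(* its probability whenever it is measurable.                                 *)
Definition success_probability (P : probability function_space R)
    (A : parallel_algorithm) (tau : R) : \bar R :=
  mu_ext P
    (F `&` [set f | (rounds A f <= tau%:E)%E] : set function_space).

Definition compl_HP (gamma : R) : \bar R :=
  ereal_sup [set
    ereal_inf [set
      ereal_inf [set tau%:E | tau in
        [set tau : R | (gamma%:E <= success_probability P A tau)%E]]
    | A in [set: parallel_algorithm]]
  | P in distributions].

End oracle_model.

(* The right-hand side of the fixed-point equation for M.  Where the          *)
(* logarithm is not positive, the second term of the minimum is read as +oo   *)
(* (its limit as the logarithm decreases to 0).  With this convention the     *)
(* equation M = rounds_bound d K eps gamma M has exactly one solution M for   *)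
(* all admissible values of the parameters.                                   *)
Definition rounds_bound {R : realType} (d K : nat) (eps gamma M : R) : R :=
  let L := ln (M * K%:R / gamma) in
  let M1 := 1 / (200 * eps ^+ 2) in
  if 0 < L then
    Num.min M1 (eps * Num.sqrt d%:R / (32 * Num.sqrt L))
  else M1.

(* Main.v *)
(**
  The hard distribution is uniform over the functions
  [f_z x = max_(i < N) (b <z_i, x> - 2 a i) / 2], where [z_0, ..., z_(N - 1)] are
  independent random sign vectors, [b = d^(1/p - 1)], [N] is the largest integer
  below [M] and [a = 4 sqrt (ln (M K / gamma) / d)].  A subgradient of [f_z] has
  coordinates at most [b / 2] in absolute value, which puts [f_z] in the class.
  If all answers of round [t] (counted from 0) depended on [z_0, ..., z_t] only,
  then the queries of round [t] would be independent of [z_t, ..., z_(N - 1)], so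
  that by subgaussian tails and a union bound all products [b <z_i, x>] with
  [i >= t] would be smaller than [a] in absolute value.  The shifts [2 a i] then
  make the pieces after [t] inactive near the queries of round [t], and
  locality of the oracle turns the assumption into a fact.  Hence in each of the
  [N] rounds [f_z >= - N a] at the queries, whereas near orthogonality of the
  [z_i] gives [f_z u <= - 1 / (8 sqrt N)] at a suitable negative multiple [u] of
  [\sum_i z_i].
*)
Require Import Defs.
From HB Require Import structures.
From mathcomp Require Import all_boot all_order all_algebra.
From mathcomp Require Import ring lra zify.
From mathcomp Require Import all_classical all_reals all_analysis.

Set Implicit Arguments.
Unset Strict Implicit.
Unset Printing Implicit Defensive.

Import Order.TTheory GRing.Theory Num.Theory.
Import numFieldNormedType.Exports.

Local Open Scope classical_set_scope.
Local Open Scope ring_scope.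

(** * Subgaussian tails of uniform random sign vectors *)

Lemma expR_sym_le {R : realType} (y : R) :
  expR y + expR (- y) <= 2 * expR (y ^+ 2).
Proof.
wlog y0 : y / 0 <= y.
  move=> H; case: (leP 0 y) => [|/ltW y0]; first exact: H.
  by rewrite addrC -(sqrrN y) -{2}(opprK y); apply: H; rewrite oppr_ge0.
(* For small [u], the bound [expR w <= (1 - w / 2) ^- 2], applied to [u] and [- u], leaves a
   rational inequality in [v = u ^+ 2]. *)
have small (u : R) : 0 <= u <= 1 / 2 -> expR u + expR (- u) <= 2 * expR (u ^+ 2).
  move=> /andP[u0 u1].
  have inv_sq (w : R) : w <= 1 / 2 -> expR w <= ((1 - w / 2) ^+ 2)^-1.
    move=> w1; have h : 0 < 1 - w / 2 by lra.
    have -> : expR w = (expR (- (w / 2)) ^+ 2)^-1.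
      by rewrite expRN exprVn invrK -expRM_natl; congr expR; field.
    rewrite lef_pV2 ?posrE ?exprn_gt0 ?expR_gt0 //.
    by rewrite lerXn2r ?nnegrE ?expR_ge0 ?(ltW h) //; exact: expR_ge1Dx.
  apply: (le_trans (lerD (inv_sq u u1) (inv_sq (- u) _))); first by lra.
  have h : 1 + u ^+ 2 <= expR (u ^+ 2) by exact: expR_ge1Dx.
  apply: (@le_trans _ _ (2 * (1 + u ^+ 2))); last by lra.
  have h1 : 0 < 1 - u / 2 by lra.
  have h2 : 0 < 1 + u / 2 by lra.
  rewrite [X in X <= _](_ : _ =
     ((1 + u / 2) ^+ 2 + (1 - u / 2) ^+ 2) / ((1 - u / 2) * (1 + u / 2)) ^+ 2);
    last by field; apply/andP; split; rewrite gt_eqF; lra.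
  rewrite ler_pdivrMr ?exprn_gt0 ?mulr_gt0 //.
  set v := u ^+ 2.
  have v0 : 0 <= v by exact: sqr_ge0.
  have v1 : v <= 1 / 4 by rewrite /v; nra.
  rewrite (_ : (_ + _) = 2 * (1 + v / 4)); last by rewrite /v; field.
  rewrite (_ : (_ * _) ^+ 2 = (1 - v / 4) ^+ 2); last by rewrite /v; field.
  nra.
case: (leP 1 y) => y1.
  have h1 : expR y <= expR (y ^+ 2) by rewrite ler_expR; nra.
  have h2 : expR (- y) <= expR (y ^+ 2) by rewrite ler_expR; nra.
  lra.
(* cosh y = 2 (cosh (y / 2))^2 - 1 lifts the inequality from y / 2 to y *)
have /small h : 0 <= y / 2 <= 1 / 2 by apply/andP; split; lra.
move: h; set A := expR (y / 2); set B := expR (- (y / 2)); set C := expR _ => h.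
have -> : expR y = A ^+ 2 by rewrite /A -expRM_natl; congr expR; field.
have -> : expR (- y) = B ^+ 2 by rewrite /B -expRM_natl; congr expR; field.
have -> : expR (y ^+ 2) = C ^+ 4.
  by rewrite /C -expRM_natl; congr expR; field.
have AB : A * B = 1 by rewrite /A /B -expRD subrr expR0.
have A0 : 0 < A by exact: expR_gt0.
have B0 : 0 < B by exact: expR_gt0.
have C0 : 0 < C by exact: expR_gt0.
have : (A + B) ^+ 2 <= (2 * C) ^+ 2.
  by rewrite lerXn2r ?nnegrE ?addr_ge0 ?mulr_ge0 ?(ltW A0) ?(ltW B0) ?(ltW C0).
have : 0 <= (C ^+ 2 - 1) ^+ 2 by exact: sqr_ge0.
have -> : (A + B) ^+ 2 = A ^+ 2 + B ^+ 2 + 2 * (A * B) by ring.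
rewrite AB (_ : (C ^+ 2 - 1) ^+ 2 = C ^+ 4 - 2 * C ^+ 2 + 1); last by ring.
rewrite (_ : (2 * C) ^+ 2 = 4 * C ^+ 2); last by ring.
lra.
Qed.

Section sign_vectors.
Context {R : realType} {d : nat}.
Local Notation signs := {ffun 'I_d -> bool}.

Definition sdot (s : signs) (x : 'I_d -> R) : R := \sum_l (-1) ^+ s l * x l.

(** The exponential moment factorizes over the coordinates, and [expR_sym_le] bounds each factor. *)
Lemma sum_expR_sdot (x : 'I_d -> R) :
  \sum_(s : signs) expR (sdot s x) <= 2 ^+ d * expR (\sum_l x l ^+ 2).
Proof.
have expR_sumE (F : 'I_d -> R) : expR (\sum_l F l) = \prod_l expR (F l).
  by apply: (big_morph _ (@expRD R) (@expR0 R)).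
under eq_bigr do rewrite /sdot expR_sumE.
rewrite -(bigA_distr_bigA (fun l (b : bool) => expR ((-1) ^+ b * x l))).
rewrite expR_sumE -[d in 2 ^+ d]card_ord -prodr_const -big_split /=.
apply: ler_prod => l _; rewrite big_bool /= expr1 expr0 mul1r mulN1r.
by rewrite addr_ge0 ?expR_ge0 //= addrC expR_sym_le.
Qed.

(** Chernoff's bound, stated by counting; [lam] minimizes the exponent
    [lam ^+ 2 * r ^+ 2 - lam * tau]. *)
Lemma sdot_tail (x : 'I_d -> R) (r tau : R) :
  0 < r -> \sum_l x l ^+ 2 <= r ^+ 2 -> 0 < tau ->
  \sum_(s : signs) (tau <= sdot s x)%R%:R <=
    2 ^+ d * expR (- ((tau / r) ^+ 2 / 4)).
Proof.
move=> r0 xr tau0; set lam := tau / (2 * r ^+ 2).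
have lam0 : 0 < lam by rewrite divr_gt0 ?mulr_gt0 ?exprn_gt0.
apply: (@le_trans _ _ (\sum_(s : signs) expR (sdot s (fun l => lam * x l)) *
                       expR (- (lam * tau)))).
  apply: ler_sum => s _; rewrite -expRD.
  case: (leP tau (sdot s x)) => h /=; last exact: expR_ge0.
  apply: le_trans (expR_ge1Dx _); rewrite lerDl subr_ge0.
  rewrite [X in _ <= X](_ : _ = lam * sdot s x) ?ler_pM2l //.
  by rewrite /sdot mulr_sumr; apply: eq_bigr => l _; rewrite mulrCA.
rewrite -mulr_suml.
apply: (le_trans (ler_wpM2r (expR_ge0 _) (sum_expR_sdot _))).
rewrite -mulrA ler_wpM2l ?exprn_ge0 // -expRD ler_expR.
under eq_bigr do rewrite exprMn.
rewrite -mulr_sumr.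
have : lam ^+ 2 * (\sum_l x l ^+ 2) <= lam ^+ 2 * r ^+ 2.
  by rewrite ler_wpM2l ?sqr_ge0.
suff -> : - ((tau / r) ^+ 2 / 4) = lam ^+ 2 * r ^+ 2 - lam * tau.
  by move=> h; rewrite lerD2r.
by rewrite /lam; field; rewrite gt_eqF.
Qed.

Context {N : nat}.
Local Notation vectors := {ffun 'I_N -> signs}.

Definition flip (j : 'I_N) (s : signs) (z : vectors) : vectors :=
  [ffun i => if i == j then [ffun l => z i l (+) s l] else z i].

Lemma flipK j s : involutive (flip j s).
Proof.
move=> z; apply/ffunP => i; rewrite !ffunE; case: eqP => // _.
by apply/ffunP => l; rewrite !ffunE addbK.
Qed.

Lemma flip_neq i j s z : i != j -> flip j s z i = z i.
Proof. by move=> /negbTE h; rewrite ffunE h. Qed.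

(* Averaging over the flips of coordinate [j] plays the role of conditioning
   on the other coordinates, with respect to which [x] is measurable. *)
Lemma indep_tail (j : 'I_N) (x : vectors -> 'I_d -> R) (r tau : R) :
  (forall s z, x (flip j s z) = x z) ->
  0 < r -> (forall z, \sum_l x z l ^+ 2 <= r ^+ 2) -> 0 < tau ->
  \sum_(z : vectors) (tau <= sdot (z j) (x z))%R%:R <=
    #|{: vectors}|%:R * expR (- ((tau / r) ^+ 2 / 4)).
Proof.
move=> xj r0 xr tau0.
have c0 : 0 < 2 ^+ d :> R by rewrite exprn_gt0.
rewrite -(ler_pM2l c0).
(* The factor [2 ^+ d] makes room for a sum over all [s]; each flip permutes the families [z] and
   fixes [x z]. *)
have -> : 2 ^+ d * \sum_(z : vectors) (tau <= sdot (z j) (x z))%R%:R =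
   \sum_(s : signs) \sum_(z : vectors)
      (tau <= sdot (flip j s z j) (x z))%R%:R :> R.
  rewrite -[2 ^+ d](_ : #|{: signs}|%:R = _); last first.
    by rewrite card_ffun card_bool card_ord natrX.
  rewrite mulr_natl -sumr_const; apply: eq_bigr => s _.
  rewrite (reindex_inj (can_inj (flipK j s))).
  by apply: eq_bigr => z _; rewrite xj.
rewrite exchange_big /= mulrCA [X in _ <= X]mulr_natl -sumr_const.
apply: ler_sum => z _.
(* For fixed [z], the signs of [z j] move from the flipped vector into [y], which has the norm of
   [x z]. *)
pose y l := (-1) ^+ z j l * x z l.
have -> : \sum_(s : signs) (tau <= sdot (flip j s z j) (x z))%R%:R =
          \sum_(s : signs) (tau <= sdot s y)%R%:R :> R.
  apply: eq_bigr => s _; congr ((_ <= _)%R%:R).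
  apply: eq_bigr => l _; rewrite !ffunE eqxx ffunE /y mulrA -signr_addb.
  by rewrite addbC.
apply: sdot_tail => //.
by under eq_bigr do rewrite /y exprMn sqrr_sign mul1r.
Qed.

End sign_vectors.

(** * The uniform distribution over a finite family *)

Section uniform_distribution.
Context d (T : measurableType d) {R : realType} {I : finType}.
Variables (i0 : I) (f : I -> T).

(** [msum] runs over natural numbers, hence the enumeration of [I]; the default [i0] is never
    reached. Values of [f] count with multiplicity. *)
Definition uniform_on : set T -> \bar R :=
  mscale (#|I|%:R^-1)%:nng (msum (fun n => \d_(f (nth i0 (enum I) n))) #|I|).

HB.instance Definition _ := Measure.on uniform_on.

Lemma uniform_onE (A : set T) :
  uniform_on A = ((\sum_i (f i \in A)%:R) / #|I|%:R)%:E.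
Proof.
rewrite /uniform_on /mscale /= /msum.
transitivity ((#|I|%:R^-1 : R)%:E *
    \sum_(n < #|I|) ((f (nth i0 (enum I) n) \in A)%:R : R)%:E)%E.
  by congr (_ * _)%E; apply: eq_bigr => n _; rewrite /= diracE.
rewrite sumEFin -EFinM mulrC; congr ((_ * _)%:E).
rewrite [RHS](reindex _ (onW_bij _ (@enum_val_bij I))).
by apply: eq_bigr => n _; rewrite (enum_val_nth i0).
Qed.

Let uniform_on_setT : uniform_on [set: T] = 1%E.
Proof.
rewrite uniform_onE; congr EFin.
under eq_bigr do rewrite in_setT.
rewrite sumr_const -[#|_|]/#|I| mulr1n divff // pnatr_eq0 -lt0n.
by apply/card_gt0P; exists i0.
Qed.

HB.instance Definition _ :=
  Measure_isProbability.Build _ _ _ uniform_on uniform_on_setT.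

End uniform_distribution.

(** * Convex functions on the line and their rational values *)

Section convex_on_rationals.
Context {R : realType}.

(** Convexity bounds [phi x] through the rationals [q < x < c], and [psi] at [q] through
    [a < q < x]. As [q] is at distance [h] from [x] and [a], [c] are at distance more than 1, this
    gives [phi x - psi x <= 4 * h * C], while [eta] is chosen so that [8 * h * C] is below the
    assumed gap. *)
Lemma convex_line_le (phi psi : R -> R) :
  (forall t x y : R, 0 <= t <= 1 ->
     phi (t * x + (1 - t) * y) <= t * phi x + (1 - t) * phi y) ->
  (forall t x y : R, 0 <= t <= 1 ->
     psi (t * x + (1 - t) * y) <= t * psi x + (1 - t) * psi y) ->
  (forall q : rat, phi (ratr q) = psi (ratr q)) ->
  forall x, phi x <= psi x.
Proof.
move=> cphi cpsi e x; rewrite leNgt; apply/negP => lt.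
have [a] : exists a : rat, ratr a \in `]x - 2, x - 1[ by apply: rat_in_itvoo; lra.
rewrite in_itv /= => /andP[a1 a2].
have [c] : exists c : rat, ratr c \in `]x + 1, x + 2[ by apply: rat_in_itvoo; lra.
rewrite in_itv /= => /andP[c1 c2].
set C : R := `|psi x| + `|psi (ratr a)| + `|psi (ratr c)| + 1.
have /andP[xC1 xC2] : - C <= psi x <= C.
  rewrite -ler_norml /C -!addrA lerDl; do !rewrite addr_ge0 //.
have /andP[aC1 aC2] : - C <= psi (ratr a) <= C.
  rewrite -ler_norml /C (addrC `|psi x|) -!addrA lerDl; do !rewrite addr_ge0 //.
have /andP[cC1 cC2] : - C <= psi (ratr c) <= C.
  rewrite -ler_norml /C (addrC _ `|psi (ratr c)|) -!addrA lerDl.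
  by do !rewrite addr_ge0 //.
have C0 : 0 < C by rewrite /C ltr_wpDl // !addr_ge0.
set eta := Num.min 1 ((phi x - psi x) / (8 * C)).
have eta0 : 0 < eta by rewrite lt_min ltr01 divr_gt0 ?subr_gt0 ?mulr_gt0.
have [q] : exists q : rat, ratr q \in `]x - eta, x[ by apply: rat_in_itvoo; lra.
rewrite in_itv /= => /andP[q1 q2].
have eta1 : eta <= 1 by rewrite ge_min lexx.
have eta2 : eta * (8 * C) <= phi x - psi x.
  by rewrite -ler_pdivlMr ?mulr_gt0 // ge_min lexx orbT.
set h := x - ratr q.
have h0 : 0 < h by rewrite /h; lra.
have hC : h * (8 * C) < phi x - psi x.
  by apply: lt_le_trans eta2; rewrite ltr_pM2r ?mulr_gt0 //; rewrite /h; lra.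
(* [x] lies between [q] and [c], and [q] between [a] and [x] *)
set s := h / (ratr c - ratr q); set t := h / (x - ratr a).
have /andP[s0 s1] : 0 <= s <= h.
  rewrite divr_ge0 ?(ltW h0) //=; last by lra.
  by rewrite ler_pdivrMr ?ler_peMr ?(ltW h0) //; lra.
have /andP[t0 t1] : 0 <= t <= h.
  rewrite divr_ge0 ?(ltW h0) //=; last by lra.
  by rewrite ler_pdivrMr ?ler_peMr ?(ltW h0) //; lra.
have h1 : h < 1 by rewrite /h; lra.
have := cphi s (ratr c) (ratr q).
have -> : s * ratr c + (1 - s) * ratr q = x.
  by rewrite /s /h; field; rewrite gt_eqF //; lra.
have := cpsi t (ratr a) x.
have -> : t * ratr a + (1 - t) * x = ratr q.
  by rewrite /t /h; field; rewrite gt_eqF //; lra.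
rewrite !e => H2 H1.
clear cphi cpsi eta2; clearbody eta s t; clearbody h C.
have {}H1 : phi x <= s * psi (ratr c) + (1 - s) * psi (ratr q).
  by apply: H1; rewrite s0 (le_trans s1 (ltW h1)).
have {}H2 : psi (ratr q) <= t * psi (ratr a) + (1 - t) * psi x.
  by apply: H2; rewrite t0 (le_trans t1 (ltW h1)).
have tC : t * (psi (ratr a) - psi x) <= h * (2 * C).
  apply: (@le_trans _ _ (t * (2 * C))); first by rewrite ler_wpM2l //; lra.
  by rewrite ler_pM2r //; lra.
have sC : s * (psi (ratr c) - psi x) <= h * (2 * C).
  apply: (@le_trans _ _ (s * (2 * C))); first by rewrite ler_wpM2l //; lra.
  by rewrite ler_pM2r //; lra.
have : (1 - s) * (psi (ratr q) - psi x) <= 1 * (h * (2 * C)).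
  apply: (@le_trans _ _ ((1 - s) * (h * (2 * C)))).
    by rewrite ler_wpM2l //; lra.
  by rewrite ler_wpM2r ?mulr_ge0 //; lra.
lra.
Qed.

End convex_on_rationals.

(** * Outer measure of sets that contain the whole family *)

Section uniform_on_cover.
Context d (T : measurableType d) {R : realType} {I : finType}.
Variables (i0 : I) (f : I -> T).
Local Notation P := (uniform_on (R := R) i0 f).

(** Every measurable cover of [S] contains all [f i] and so has full mass. This puts the
    distribution on the function class, measurable or not. *)
Lemma mu_ext_uniform_on (S : set T) : (forall i, S (f i)) -> mu_ext P S = 1%E.
Proof.
move=> Sf; apply/eqP; rewrite eq_le; apply/andP; split.
  rewrite -(@probability_setT _ _ _ P) -(measurable_mu_extE P measurableT).
  exact: le_mu_ext.
apply: le_ereal_inf_tmp => _ [A [mA SA] <-].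
have mU : measurable (\bigcup_n A n) by exact: bigcupT_measurable.
apply: (@le_trans _ _ (P (\bigcup_n A n))); last exact: measure_sigma_subadditive.
rewrite -(@probability_setT _ _ _ P) le_eqVlt; apply/orP; left; apply/eqP.
rewrite [LHS]uniform_onE [RHS]uniform_onE; congr ((_ / _)%:E).
apply: eq_bigr => i _; rewrite in_setT mem_set //; exact/SA/Sf.
Qed.

End uniform_on_cover.

(** * Convex functions in several variables and outer measure *)

Section convex_functions.
Context {R : realType} {d : nat}.
Local Notation V := 'rV[R]_d.
Local Notation convex f := (convex_function [set: convex_lmodType V] f).

Lemma convex_functionP (f : V -> R) :
  convex f <-> forall t x y, 0 <= t <= 1 ->
    f (t *: x + (1 - t) *: y) <= t * f x + (1 - t) * f y.
Proof.
split=> [cf t x y /andP[t0 t1]|cf t x y _ _].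
  have := cf (Itv01 t0 t1) x y; rewrite !inE => /(_ Logic.I Logic.I).
  by rewrite convRE.
by rewrite convRE; apply: cf; rewrite ge0 le1.
Qed.

Definition update (x : V) (j : 'I_d) (r : R) : V :=
  \row_i if i == j then r else x ord0 i.

Lemma convex_eq_rat (f g : V -> R) : convex f -> convex g ->
  (forall u : 'rV[rat]_d, f (map_mx ratr u) = g (map_mx ratr u)) -> f = g.
Proof.
move=> /convex_functionP cf /convex_functionP cg e; apply/funext => x.
have convex_update (h : V -> R) j y : 
    (forall t x y, 0 <= t <= 1 ->
      h (t *: x + (1 - t) *: y) <= t * h x + (1 - t) * h y) ->
    forall t a b : R, 0 <= t <= 1 -> h (update y j (t * a + (1 - t) * b)) <=
      t * h (update y j a) + (1 - t) * h (update y j b).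
  move=> ch t a b t01; apply: le_trans (ch _ _ _ t01).
  rewrite (_ : update _ _ _ = t *: update y j a + (1 - t) *: update y j b) //.
  by apply/rowP => i; rewrite !mxE; case: ifP => // _; ring.
(* Induction on the number [k] of leading coordinates that may be irrational; each step frees one
   coordinate by the result on the line. *)
suff H k : forall y : V,
    (forall i : 'I_d, (k <= i)%N -> exists q : rat, y ord0 i = ratr q) ->
    f y = g y.
  by apply: (H d) => i; rewrite leqNgt ltn_ord.
elim: k => [|k IH] y yk.
  have [q qE] := choice (fun i => yk i (leq0n _)).
  rewrite (_ : y = map_mx ratr (\row_i q i)) //.
  by apply/rowP => i; rewrite !mxE qE.
case: (ltnP k d) => kd; last first.
  by apply: IH => i /(leq_trans kd); rewrite leqNgt ltn_ord.
pose j := Ordinal kd.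
have fg (q : rat) : f (update y j (ratr q)) = g (update y j (ratr q)).
  apply: IH => i; rewrite leq_eqVlt mxE => /orP[/eqP ki|ki].
    by exists q; rewrite ifT //; apply/eqP/val_inj.
  by rewrite ifF; [exact: yk | rewrite -val_eqE gtn_eqF].
rewrite (_ : y = update y j (y ord0 j)); last first.
  by apply/rowP => i; rewrite mxE; case: eqP => // ->.
apply/eqP; rewrite eq_le; apply/andP; split.
  apply: (@convex_line_le _ (f \o update y j) (g \o update y j)) => //=.
  - exact: convex_update.
  - exact: convex_update.
apply: (@convex_line_le _ (g \o update y j) (f \o update y j)) => //=.
- exact: convex_update.
- exact: convex_update.
Qed.

Local Notation T := (function_space (R := R) (d := d)).

Lemma measurable_evaluation (x : V) (c : R) :
  measurable ([set h | h x = c] : set T).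
Proof.
apply: sub_sigma_algebra; exists x => //.
exists [set c]; first exact: measurable_set1.
by rewrite setTI.
Qed.

(* Measurable sets only see countably many evaluations, so a cover of [S] that
   avoids [f i] exists because a convex function is determined by its values at
   the rational points. *)
Lemma mu_ext_uniform_on_convex (I : finType) (i0 : I) (f : I -> V -> R)
    (S : set (V -> R)) : (forall i, convex (f i)) -> (forall h, S h -> convex h) ->
  (mu_ext (uniform_on (R := R) (i0 : I) (f : I -> T)) (S : set T) <=
   ((\sum_i (f i \in S)%:R) / #|I|%:R)%:E)%E.
Proof.
move=> cf cS.
(* [unpickle] enumerates the rational points, so the intersection is countable; [f i] is the only
   convex function in [C i]. *)
pose C i : set T := \bigcap_(n in [set: nat])
  if unpickle n is Some u then
    [set h : V -> R | h (map_mx ratr (u : 'rV[rat]_d)) = f i (map_mx ratr u)]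
  else setT.
have mC i : measurable (C i).
  apply: bigcapT_measurable => n; case: unpickle => [u|]; last exact: measurableT.
  exact: measurable_evaluation.
have CP i h : C i h <->
    forall u : 'rV[rat]_d, h (map_mx ratr u) = f i (map_mx ratr u).
  split=> [Ch u|Ch n _]; first by have := Ch (pickle u) Logic.I; rewrite pickleK.
  by case: unpickle => // u; exact: Ch.
pose B : set T := \bigcap_(i in [set i | f i \notin S]) ~` C i.
have mB : measurable B.
  apply: fin_bigcap_measurable => [|i _]; first exact: finite_finset.
  exact: measurableC.
have SB : (S : set T) `<=` B.
  move=> h Sh i /= iS /CP hi.
  by move: iS; rewrite -(convex_eq_rat (cS _ Sh) (cf i) hi) mem_set.
apply: (le_trans (le_mu_ext _ SB)).
rewrite measurable_mu_extE // [X in (X <= _)%E]uniform_onE lee_fin.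
rewrite ler_wpM2r ?invr_ge0 //; apply: ler_sum => i _.
case: (boolP (f i \in S)) => iS; first by case: (_ \in B).
by rewrite memNset // => /(_ i iS); apply; apply/CP.
Qed.

End convex_functions.

(** * The hard functions: convexity, subgradients, local behaviour *)

Section hard_functions.
Context {R : realType} {d n : nat}.
Local Notation V := 'rV[R]_d.
Local Notation vectors := {ffun 'I_n.+1 -> {ffun 'I_d -> bool}}.
Variables (b a : R).
Hypothesis b0 : 0 < b.
Implicit Types (z w : vectors) (x y : V) (t : nat).

Definition piece z (i : 'I_n.+1) x : R :=
  (b * sdot (z i) (x ord0) - i%:R * (2 * a)) / 2.

(* The hard function is [hard z n]; [hard z t] agrees with it near every point
   queried in round [t], counted from 0. *)
Definition hard z t x : R :=
  \big[Num.max/piece z ord0 x]_(i < n.+1 | (i <= t)%N) piece z i x.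

(** The default of the maximum is the piece of index 0, which satisfies [i <= t] anyway. *)
Lemma hard_leP z t x c :
  hard z t x <= c <-> forall i : 'I_n.+1, (i <= t)%N -> piece z i x <= c.
Proof.
split=> [/bigmax_leP[] //|H].
by apply/bigmax_leP; split => [|i]; apply: H.
Qed.

Lemma piece_le_hard z t x (i : 'I_n.+1) : (i <= t)%N ->
  piece z i x <= hard z t x.
Proof. by move=> it; have /hard_leP/(_ i it) := lexx (hard z t x). Qed.

Lemma eq_hard z w t : (forall i : 'I_n.+1, (i <= t)%N -> z i = w i) ->
  hard z t = hard w t.
Proof.
move=> e; apply/funext => x; rewrite /hard /piece e //.
by apply: eq_bigr => i it; rewrite e.
Qed.

Lemma sdot_comb (s : {ffun 'I_d -> bool}) u v x y :
  sdot s ((u *: x + v *: y) ord0) = u * sdot s (x ord0) + v * sdot s (y ord0).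
Proof.
rewrite /sdot !mulr_sumr -big_split; apply: eq_bigr => l _ /=.
by rewrite !mxE; ring.
Qed.

Lemma sdot_delta (s : {ffun 'I_d -> bool}) (l : 'I_d) :
  sdot s ((delta_mx ord0 l : V) ord0) = (-1) ^+ s l.
Proof.
rewrite /sdot (bigD1 l) //= mxE !eqxx mulr1 big1 ?addr0 // => k /negbTE kl.
by rewrite mxE kl mulr0.
Qed.

Lemma convex_hard z t :
  convex_function [set: convex_lmodType V] (hard z t).
Proof.
apply/convex_functionP => u x y /andP[u0 u1]; apply/hard_leP => i it.
apply: (@le_trans _ _ (u * piece z i x + (1 - u) * piece z i y)).
  by rewrite /piece sdot_comb le_eqVlt; apply/orP; left; apply/eqP; field.
by apply: lerD; apply: ler_wpM2l; rewrite ?subr_ge0 //; apply: piece_le_hard.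
Qed.

(** Steps along the axes suffice: with [e = 1] and [e = -1] the subgradient inequality then bounds
    each entry of a subgradient. *)
Lemma hard_lipschitz z t x (l : 'I_d) (e : R) :
  hard z t (x + e *: delta_mx ord0 l) <= hard z t x + b / 2 * `|e|.
Proof.
apply/hard_leP => i it; apply: le_trans (lerD (piece_le_hard z x it) (lexx _)).
rewrite /piece -[x]scale1r sdot_comb scale1r mul1r.
rewrite sdot_delta.
have : e * (-1) ^+ z i l <= `|e|.
  by apply: le_trans (ler_norm _) _; rewrite normrM normrX normrN1 expr1n mulr1.
by rewrite -(ler_pM2l b0); lra.
Qed.

Lemma subdifferential_hard z t x g l :
  subdifferential (hard z t) x g -> `|g ord0 l| <= b / 2.
Proof.
move=> /= gx.
have dotE (e : R) : e * g ord0 l <= b / 2 * `|e|.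
  have := le_trans (gx (x + e *: delta_mx ord0 l)) (hard_lipschitz z t x l e).
  rewrite lerD2l addrAC subrr add0r /dot (bigD1 l) //= big1 => [|k /negbTE kl].
    by rewrite !mxE !eqxx mulr1 addr0 mulrC.
  by rewrite !mxE kl !mulr0.
rewrite ler_norml; apply/andP; split.
  by have := dotE (-1); rewrite normrN1; lra.
by have := dotE 1; rewrite normr1; lra.
Qed.

Lemma continuous_piece z i : continuous (piece z i : V -> R).
Proof.
move=> x; have Fx : Filter (nbhs x) by exact: nbhs_filter.
have cs : sdot (z i) (y ord0) @[y --> x] --> sdot (z i) (x ord0).
  apply: continuous_big => [|l _ y]; first exact: add_continuous.
  apply: (@cvgMl_tmp _ _ (nbhs y)); exact: coord_continuous.
by apply: cvgMr_tmp; apply: cvgB; [exact: cvgMl_tmp | exact: cvg_cst].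
Qed.

(** The finitely many later pieces lie strictly below piece [t] at [x], hence below it near [x] by
    continuity. *)
Lemma hard_locally_eq z (t : 'I_n.+1) x :
  (forall j : 'I_n.+1, (t < j)%N -> piece z j x < piece z t x) ->
  \forall y \near x, hard z n y = hard z t y.
Proof.
move=> H.
have Fx : Filter (nbhs x) by exact: nbhs_filter.
have : \forall y \near x, forall j : 'I_n.+1, (t < j)%N ->
    piece z j y <= piece z t y.
  apply: (@filter_forall _ _ _ (nbhs x)) => j.
  case: (ltnP t j) => [tj|_]; last exact: nearW.
  have c : piece z t y - piece z j y @[y --> x] --> piece z t x - piece z j x.
    by apply: cvgB; exact: continuous_piece.
  have h : 0 < piece z t x - piece z j x by rewrite subr_gt0 H.
  near=> y => _; rewrite -subr_ge0 ltW //; near: y.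
  exact: cvgr_gt c _ h.
apply: filterS => y Hy; apply/eqP; rewrite eq_le; apply/andP; split.
  apply/hard_leP => i _; case: (leqP i t) => [|/Hy h]; first exact: piece_le_hard.
  by apply: (le_trans h); apply: piece_le_hard.
by apply/hard_leP => i _; apply: piece_le_hard; rewrite -ltnS.
Unshelve. all: by end_near.
Qed.

End hard_functions.

(** * Membership in the function class *)

Section dual_norm.
Context {R : realType} {d : nat}.

(** With [q] the conjugate exponent, [(1 / p - 1) * q = -1], so each of the [d] summands is at most
    [d%:R^-1]. For [p = 1] the norm is a maximum and the bound on the entries is 1. *)
Lemma lpnorm_conjugate_le1 (p : R) (g : 'rV[R]_d) : 1 <= p ->
  (forall l, `|g ord0 l| <= d%:R `^ (1 / p - 1)) ->
  lpnorm (hoelder_conjugate p%:E) g <= 1.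
Proof.
rewrite le_eqVlt => /orP[/eqP <-|p1] gl.
  rewrite hoelder_conjugate1 /=; apply: bigmax_le => // l _.
  by apply: le_trans (gl l) _; rewrite divr1 subrr powRr0.
have d0 : (0 < d)%N \/ d = 0%N by case: d {g gl} => [|m]; [right|left].
set q := p / (p - 1).
have -> : hoelder_conjugate p%:E = q%:E.
  rewrite /hoelder_conjugate /= eqe gt_eqF /=; last by lra.
  by rewrite inver subr_eq0 gt_eqF // -EFinM.
have q0 : 0 < q by rewrite divr_gt0; lra.
have pq : (1 / p - 1) * q = - 1.
  by rewrite /q; field; apply/andP; split; rewrite gt_eqF; lra.
have e1 : 1 = 1 `^ q^-1 :> R by rewrite powR1.
rewrite /= [X in _ <= X]e1.
apply: ge0_ler_powR; rewrite ?nnegrE ?invr_ge0 ?(ltW q0) ?sumr_ge0 //.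
case: d0 => [d0|d0]; last by rewrite big1 // => -[l h]; exfalso; move: h; rewrite d0.
have dR : 0 < d%:R :> R by rewrite ltr0n.
apply: (@le_trans _ _ (\sum_(l < d) d%:R^-1)); last first.
  by rewrite sumr_const card_ord -[X in X <= _]mulr_natl divff // gt_eqF.
apply: ler_sum => l _; rewrite -powR_inv1 ?(ltW dR) // -pq [X in _ <= X]powRrM.
by apply: ge0_ler_powR; rewrite ?nnegrE ?(ltW q0) ?powR_ge0.
Qed.

(** The halving in [piece] pays for the difference of two subgradients, whose entries are then at
    most [b]. *)
Lemma hard_nonsmooth (n : nat) (p a : R) z t : 1 <= p -> (0 < d)%N ->
  nonsmooth_class p 1 (@hard R d n (d%:R `^ (1 / p - 1)) a z t).
Proof.
move=> p1 d0; have b0 : 0 < d%:R `^ (1 / p - 1) :> R.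
  by rewrite powR_gt0 // ltr0n.
split; first exact: convex_hard.
move=> x y gx gy Hx Hy; apply: lpnorm_conjugate_le1 => // l.
have := subdifferential_hard b0 l Hx; have := subdifferential_hard b0 l Hy.
by rewrite !mxE; have := ler_normB (gx ord0 l) (gy ord0 l); lra.
Qed.

End dual_norm.

Lemma euclidean_ballP {R : realType} {d : nat} (r : R) (x : 'rV[R]_d) : 0 <= r ->
  euclidean_ball r x <-> \sum_l x ord0 l ^+ 2 <= r ^+ 2.
Proof.
move=> r0; rewrite /euclidean_ball /=.
under eq_bigr do rewrite powR_mulrn // real_normK ?num_real //.
rewrite powR12_sqrt ?sumr_ge0 // => [|l _]; last exact: sqr_ge0.
set S := \sum_l _; have S0 : 0 <= S by rewrite sumr_ge0 // => l _; exact: sqr_ge0.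
rewrite -{2}(sqr_sqrtr S0); split=> H.
  by rewrite lerXn2r ?nnegrE ?sqrtr_ge0.
by move: H; rewrite ler_pXn2r ?nnegrE ?sqrtr_ge0.
Qed.

(** * The idealized interaction and its bad events *)

Section interaction.
Context {R : realType} {d n K : nat} {Ans : Type}.
Local Notation V := 'rV[R]_d.
Local Notation N := n.+1.
Local Notation signs := {ffun 'I_d -> bool}.
Local Notation vectors := {ffun 'I_N -> signs}.
Variables (b a rho : R) (O : (V -> R) -> V -> Ans).
Local Notation X := (euclidean_ball rho).
Variable A : parallel_algorithm (d := d) X Ans K.
Implicit Types (z w : vectors) (i j : 'I_N) (t : nat).

(* The transcript before round [t], counted from 0, if the answers in each round
   [t'] were computed from [hard z t'] instead of [hard z n]; it depends on the
   first [t] sign vectors only. *)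
Fixpoint visible z t : seq (('I_K -> V) * ('I_K -> Ans)) :=
  if t is t'.+1 then
    let B := next_batch A (visible z t') in
    rcons (visible z t') (B, fun k => O (hard b a z t') (B k))
  else [::].

Definition query z t (k : 'I_K) : V := next_batch A (visible z t) k.

Lemma eq_visible z w t : (forall i : 'I_N, (i < t)%N -> z i = w i) ->
  visible z t = visible w t.
Proof.
elim: t => //= t IH e; rewrite IH => [|i it]; last exact/e/leqW.
by rewrite (eq_hard b a e).
Qed.

Definition sign_vector (s : signs) : V := \row_l (-1) ^+ s l.

(* Bad events.  The pair [(i, t)] stands for the lower bound on the product of
   [z i] with a query of round [t] if [t <= i], and for the upper bound on the
   product of [z t] with a query of round [i] otherwise; likewise for the two
   bounds on the product of two sign vectors.  There are only
   [N^2 K + N (N - 1)] events: with a larger count such as [2 N^2 K] the union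
   bound fails for [N = K = 1], where ln (M K / gamma) can be close to 0. *)
Definition test (e : 'I_N * 'I_N * 'I_K + 'I_N * 'I_n) z : bool :=
  match e with
  | inl (i, t, k) => if (t <= i)%N
      then a / b <= sdot (z i) ((- query z t k) ord0)
      else a / b <= sdot (z t) (query z i k ord0)
  | inr (i, h) => let c := rho / Num.sqrt d%:R in let j := lift i h in
      if (i < j)%N
      then a / b <= sdot (z j) ((c *: sign_vector (z i)) ord0)
      else a / b <= sdot (z i) ((- c *: sign_vector (z j)) ord0)
  end.

Definition good z : bool := [forall e, ~~ test e z].

Hypotheses (d0 : (0 < d)%N) (b0 : 0 < b) (a0 : 0 < a) (rho0 : 0 < rho).
Hypothesis brho : b * rho * Num.sqrt d%:R = 1.

Lemma sdot_scale (s : signs) c (x : V) :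
  sdot s ((c *: x) ord0) = c * sdot s (x ord0).
Proof. by rewrite -[_ *: _]addr0 -(scale0r x) sdot_comb mul0r addr0. Qed.

Lemma query_feasible z t k : \sum_l query z t k ord0 l ^+ 2 <= rho ^+ 2.
Proof. by apply/euclidean_ballP; [exact: ltW | exact: next_batch_feasible]. Qed.

Lemma sumr_sqr_sign_vector c (s : signs) :
  \sum_l (c *: sign_vector s) ord0 l ^+ 2 = c ^+ 2 * d%:R.
Proof.
under eq_bigr do rewrite !mxE exprMn sqrr_sign mulr1.
by rewrite sumr_const card_ord mulr_natr.
Qed.

(** In each case the tested sign vector is paired with a vector of norm at most [rho] that does not
    depend on it: a query of a round no later than its index, or another sign vector. By [brho],
    [a / b / rho] is [a * Num.sqrt d%:R]. *)
Lemma test_tail e : \sum_z (test e z)%:R <=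
  #|{: vectors}|%:R * expR (- (a ^+ 2 * d%:R / 4)).
Proof.
have dR : 0 < d%:R :> R by rewrite ltr0n.
have sd : Num.sqrt d%:R ^+ 2 = d%:R :> R by rewrite sqr_sqrtr // ltW.
have s0 : 0 < Num.sqrt d%:R :> R by rewrite sqrtr_gt0.
have -> : a ^+ 2 * d%:R / 4 = (a / b / rho) ^+ 2 / 4.
  rewrite (_ : a / b / rho = a * Num.sqrt d%:R) ?exprMn ?sd //.
  apply: (mulIf (lt0r_neq0 (mulr_gt0 b0 rho0))).
  rewrite -[RHS]mulrA (mulrC (Num.sqrt _)) brho mulr1.
  by field; apply/andP; split; rewrite gt_eqF.
have ab0 : 0 < a / b by rewrite divr_gt0.
have flip_visible i s z t : (t <= i)%N -> visible (flip i s z) t = visible z t.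
  move=> ti; apply: eq_visible => j jt; rewrite flip_neq //.
  by rewrite -val_eqE ltn_eqF //; exact: leq_trans jt ti.
have rho_sign c s : c ^+ 2 = (rho / Num.sqrt d%:R) ^+ 2 ->
    \sum_l (c *: sign_vector s) ord0 l ^+ 2 <= rho ^+ 2.
  move=> cE; rewrite sumr_sqr_sign_vector cE exprMn exprVn sd -mulrA mulVf ?mulr1 //.
  by rewrite gt_eqF.
case: e => [[[i t] k]|[i h]]; rewrite /test.
  case: leqP => it.
    apply: (indep_tail (x := fun z => (- query z t k) ord0)) => // [s z|z].
      by rewrite /query flip_visible.
    by under eq_bigr do rewrite mxE sqrrN; exact: query_feasible.
  apply: (indep_tail (x := fun z => query z i k ord0)) => // [s z|z].
    by rewrite /query flip_visible // ltnW.
  exact: query_feasible.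
case: ltnP => _.
  apply: (indep_tail (x := fun z =>
    ((rho / Num.sqrt d%:R) *: sign_vector (z i)) ord0)) => // [s z|z].
    by rewrite flip_neq // neq_lift.
  exact: rho_sign.
apply: (indep_tail (x := fun z =>
  (- (rho / Num.sqrt d%:R) *: sign_vector (z (lift i h))) ord0)) => // [s z|z].
  by rewrite flip_neq // eq_sym neq_lift.
by apply: rho_sign; rewrite sqrrN.
Qed.

Lemma bad_tail : \sum_z (~~ good z)%:R <=
  #|{: vectors}|%:R * ((N * N * K + N * n)%:R * expR (- (a ^+ 2 * d%:R / 4))).
Proof.
apply: (@le_trans _ _ (\sum_z \sum_e (test e z)%:R)).
  apply: ler_sum => z _; rewrite negb_forall; case: existsP => [[e]|_] /=.
    rewrite negbK (bigD1 e) //= => ->.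
    by rewrite lerDl sumr_ge0 // => ? _; exact: ler0n.
  by rewrite sumr_ge0 // => ? _; exact: ler0n.
rewrite exchange_big /= mulrCA mulr_natl.
rewrite -[(_ + _)%N](_ : #|{: 'I_N * 'I_N * 'I_K + 'I_N * 'I_n}| = _); last first.
  by rewrite card_sum !card_prod !card_ord.
by rewrite -sumr_const; apply: ler_sum => e _; exact: test_tail.
Qed.

Lemma good_query_gt z i (t : 'I_N) k : good z -> (t <= i)%N ->
  - a < b * sdot (z i) (query z t k ord0).
Proof.
move=> /forallP/(_ (inl (i, t, k))) /= + ti; rewrite ti -ltNge.
by rewrite ltr_pdivlMr // mulrC -scaleN1r sdot_scale; lra.
Qed.

Lemma good_query_lt z j (t : 'I_N) k : good z -> (t < j)%N ->
  b * sdot (z j) (query z t k ord0) < a.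
Proof.
move=> /forallP/(_ (inl (t, j, k))) /= + tj; rewrite leqNgt tj /= -ltNge.
by rewrite ltr_pdivlMr // mulrC.
Qed.

Lemma sdot_sign_vectorC (s s' : signs) :
  sdot s (sign_vector s' ord0) = sdot s' (sign_vector s ord0).
Proof. by apply: eq_bigr => l _; rewrite !mxE mulrC. Qed.

(** The tests use sign vectors scaled by [c] to norm [rho]; since [b * c * d%:R = 1], undoing the
    scaling turns the threshold [a / b] into [d%:R * a]. *)
Lemma good_near_orthogonal z i j : good z -> i != j ->
  `|sdot (z i) (sign_vector (z j) ord0)| <= d%:R * a.
Proof.
wlog ij : i j / (i < j)%N => [H g ij|].
  case: (ltngtP i j) => [h|h|/val_inj h]; first exact: H.
    by rewrite sdot_sign_vectorC; apply: H; rewrite // eq_sym.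
  by rewrite h eqxx in ij.
move=> /forallP g neq_ij; rewrite sdot_sign_vectorC.
have dR : 0 < d%:R :> R by rewrite ltr0n.
have s0 : 0 < Num.sqrt d%:R :> R by rewrite sqrtr_gt0.
set c := rho / Num.sqrt d%:R; set S := sdot _ _.
have bc : b * c * d%:R = 1.
  rewrite -[in X in _ * X = _](sqr_sqrtr (ltW dR)) -[RHS]brho /c.
  by field; rewrite gt_eqF.
have H1 : b * c * S < a.
  have [h hE|hE] := unliftP i j; last by rewrite hE eqxx in neq_ij.
  have := g (inr (i, h)); rewrite /test -hE ij -ltNge sdot_scale.
  by rewrite ltr_pdivlMr // mulrC mulrA.
have H2 : - (b * c * S) < a.
  have [h hE|hE] := unliftP j i; last by rewrite hE eqxx in neq_ij.
  have := g (inr (j, h)); rewrite /test -hE ltnNge (ltnW ij) -ltNge sdot_scale.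
  by rewrite ltr_pdivlMr // mulrC mulrA mulrN mulNr.
have -> : S = d%:R * (b * c * S) by rewrite mulrA (mulrC d%:R) bc mul1r.
rewrite normrM ger0_norm ?(ltW dR) // ler_pM2l //.
by rewrite ler_norml (ltW H1) andbT lerNl ltW.
Qed.

End interaction.

(** * Rounds needed on a good instance *)

Section rounds_of_good_instances.
Context {R : realType} {d n K : nat} {Ans : Type}.
Local Notation V := 'rV[R]_d.
Local Notation N := n.+1.
Local Notation vectors := {ffun 'I_N -> {ffun 'I_d -> bool}}.
Variables (F : set (V -> R)) (b a rho : R) (O : (V -> R) -> V -> Ans).
Local Notation X := (euclidean_ball rho).
Variable A : parallel_algorithm (d := d) X Ans K.
Variables (z : vectors) (eps : R).
Local Notation f := (hard b a z n).

Hypotheses (d0 : (0 < d)%N) (b0 : 0 < b) (a0 : 0 < a) (rho0 : 0 < rho).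
Hypothesis brho : b * rho * Num.sqrt d%:R = 1.
Hypothesis hard_F : forall t, F (hard b a z t).
Hypothesis local_O : local_oracle F X O.
Hypothesis good_z : good b a O A z.

(** Induction on rounds. At a query of round [t] the unshifted term of piece [t] exceeds [- a], that
    of a later piece is below [a], and their shifts differ by at least [2 * a]; so the later pieces
    are inactive nearby and locality applies. *)
Lemma transcript_visible t : (t <= n)%N ->
  transcript O A f t = visible b a O A z t.
Proof.
elim: t => //= t IH tn; rewrite IH ?(ltnW tn) //; congr (rcons _ (_, _)).
apply/funext => k; apply: local_O => //; first exact: next_batch_feasible.
have tN : (t < N)%N by exact: ltnW.
apply: (hard_locally_eq (t := Ordinal tN)) => // j tj.
have h1 := good_query_gt (i := Ordinal tN) (t := Ordinal tN) b0 k good_z (leqnn t).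
have h2 := good_query_lt (t := Ordinal tN) b0 k good_z tj.
have : (t.+1%:R : R) <= j%:R by rewrite ler_nat.
rewrite /piece -natr1 ltr_pM2r ?invr_gt0 // => h3.
have : (t%:R + 1) * (2 * a) <= j%:R * (2 * a) by rewrite ler_pM2r ?mulr_gt0.
by move: h1 h2; rewrite /query /=; lra.
Qed.

(** The last piece alone gives this: it has the largest shift, and its sign vector is tested from
    below against the queries of all rounds. *)
Lemma hard_query_ge t k : (t <= n)%N ->
  - (N%:R * a) <= f (batch O A f t k).
Proof.
move=> tn; rewrite /batch transcript_visible //.
have h1 := good_query_gt (i := ord_max) (t := Ordinal (tn : (t < N)%N))
  b0 k good_z tn.
apply: le_trans (piece_le_hard b a z _ (leqnn n : (@ord_max n <= n)%N)).
by move: h1; rewrite /piece /query /= -natr1; have := a0; lra.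
Qed.

(** The Gram matrix [g] of the sign vectors has diagonal [d] and row sums between [d / 2] and
    [3 / 2 * d]. The row sums are the products of the [z i] with [w], and their total is the squared
    norm of [w]. *)
Lemma hard_inf_le : N%:R * a <= 1 / 2 ->
  exists2 u, X u & f u <= - (1 / (8 * Num.sqrt N%:R)).
Proof.
move=> Na.
have dR : 0 < d%:R :> R by rewrite ltr0n.
have NR : 0 < N%:R :> R by rewrite ltr0n.
have sd0 : 0 < Num.sqrt d%:R :> R by rewrite sqrtr_gt0.
have sN0 : 0 < Num.sqrt N%:R :> R by rewrite sqrtr_gt0.
have sd : Num.sqrt d%:R ^+ 2 = d%:R :> R by rewrite sqr_sqrtr // ltW.
have sN : Num.sqrt N%:R ^+ 2 = N%:R :> R by rewrite sqr_sqrtr // ltW.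
have br := brho.
set rd := Num.sqrt d%:R in sd sd0 br; set rN := Num.sqrt N%:R in sN sN0 *.
(* With this scale [- c *: w] has squared norm at most [3 / 8 * rho ^+ 2], and
   [b * c * (d%:R / 2) = 1 / (4 * rN)]. *)
pose c := rho / (2 * rd * rN).
have c0 : 0 < c by rewrite divr_gt0 // !mulr_gt0.
pose g i j := sdot (z i) (sign_vector (R := R) (z j) ord0).
have gii i : g i i = d%:R.
  rewrite /g /sdot; under eq_bigr do rewrite mxE -expr2 sqrr_sign.
  by rewrite sumr_const card_ord.
have gle i j : i != j -> `|g i j| <= d%:R * a.
  exact: (good_near_orthogonal d0 b0 brho good_z).
have offdiag i : `|\sum_(j | j != i) g i j| <= d%:R / 2.
  apply: (le_trans (ler_norm_sum _ _ _)).
  apply: (@le_trans _ _ (\sum_(j < N | j != i) d%:R * a)).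
    by apply: ler_sum => j ji; apply: gle; rewrite eq_sym.
  rewrite sumr_const cardC1 card_ord /= -[X in X <= _]mulr_natl.
  rewrite mulrCA ler_pM2l // -[2^-1]mul1r; apply: le_trans Na.
  by rewrite ler_pM2r // ler_nat.
have gsum i : d%:R / 2 <= \sum_j g i j <= 3 / 2 * d%:R.
  rewrite (bigD1 i) //= gii; have := offdiag i.
  by rewrite ler_norml => /andP[? ?]; apply/andP; split; lra.
pose w : V := \sum_i sign_vector (R := R) (z i).
have wE l : w ord0 l = \sum_i (-1) ^+ z i l.
  by rewrite /w summxE; apply: eq_bigr => i _; rewrite mxE.
have sdot_w i : sdot (z i) (w ord0) = \sum_j g i j.
  rewrite /g /sdot exchange_big; apply: eq_bigr => l _ /=.
  by rewrite wE mulr_sumr; apply: eq_bigr => j _; rewrite mxE.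
have normw : \sum_l w ord0 l ^+ 2 <= 3 / 2 * (N%:R * d%:R).
  have -> : \sum_l w ord0 l ^+ 2 = \sum_i sdot (z i) (w ord0).
    rewrite /sdot exchange_big; apply: eq_bigr => l _ /=.
    by rewrite -mulr_suml -wE expr2.
  apply: (@le_trans _ _ (\sum_(i < N) 3 / 2 * d%:R)).
    by apply: ler_sum => i _; rewrite sdot_w; have /andP[] := gsum i.
  by rewrite sumr_const card_ord -[X in X <= _]mulr_natl mulrCA.
exists (- c *: w).
  apply/euclidean_ballP; first exact: ltW.
  under eq_bigr do rewrite mxE exprMn sqrrN.
  rewrite -mulr_sumr.
  apply: (@le_trans _ _ (c ^+ 2 * (3 / 2 * (N%:R * d%:R)))).
    by rewrite ler_wpM2l // sqr_ge0.
  have -> : c ^+ 2 * (3 / 2 * (N%:R * d%:R)) = 3 / 8 * rho ^+ 2.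
    by rewrite -sN -sd /c; field; apply/andP; split; rewrite gt_eqF.
  by have : 0 <= rho ^+ 2 := sqr_ge0 _; lra.
apply/hard_leP => i _; rewrite /piece sdot_scale sdot_w.
have /andP[h _] := gsum i.
have : b * c * (d%:R / 2) <= b * c * \sum_j g i j by rewrite ler_pM2l // mulr_gt0.
have -> : b * c * (d%:R / 2) = 1 / (4 * rN).
  rewrite -[X in _ = X / _]br -sd /c.
  by field; apply/andP; split; rewrite gt_eqF.
have -> : 1 / (4 * rN) = 2 * (1 / (8 * rN)) by field; rewrite gt_eqF.
have : 0 <= i%:R * (2 * a) by rewrite mulr_ge0 // mulr_ge0 // ltW.
by rewrite mulNr mulrN mulrA; lra.
Qed.

Lemma not_eps_solution t k : (t <= n)%N -> N%:R * a <= 1 / 2 ->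
  eps + N%:R * a < 1 / (8 * Num.sqrt N%:R) ->
  ~ eps_solution X eps f (batch O A f t k).
Proof.
move=> tn Na lt_eps [_]; apply/negP; rewrite -ltNge.
have [u Xu fu] := hard_inf_le Na.
apply: (@lt_le_trans _ _ ((f (batch O A f t k))%:E - (f u)%:E)%E).
  by rewrite -EFinB lte_fin; have := hard_query_ge k tn; lra.
by rewrite leeD2lE // leeN2; apply: ereal_inf_lbound; exists u.
Qed.

(** The first [N] rounds fail and rounds are numbered from 1, so success comes in round [N.+1] at
    the earliest. *)
Lemma rounds_gt (tau : R) : tau < N.+1%:R -> N%:R * a <= 1 / 2 ->
  eps + N%:R * a < 1 / (8 * Num.sqrt N%:R) ->
  (tau%:E < rounds O eps A f)%E.
Proof.
move=> tauN Na lt_eps; apply: (@lt_le_trans _ _ (N.+1%:R)%:E).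
  by rewrite lte_fin.
apply: le_ereal_inf_tmp => _ [t [k sol] <-]; rewrite lee_fin ler_nat ltnS.
by rewrite ltnNge; apply/negP => tn; exact: (not_eps_solution tn Na lt_eps sol).
Qed.

End rounds_of_good_instances.

(** * From good instances to the complexity *)

Lemma compl_HP_ge {R : realType} {d : nat} (F : set ('rV[R]_d -> R))
    (X : set 'rV[R]_d) (Ans : Type) (O : ('rV[R]_d -> R) -> 'rV[R]_d -> Ans)
    (K : nat) (eps gamma M : R) (I : finType) (i0 : I)
    (f : I -> 'rV[R]_d -> R) :
  (forall g, F g -> convex_function [set: convex_lmodType 'rV[R]_d] g) ->
  (forall i, F (f i)) ->
  (forall (A : parallel_algorithm X Ans K) (tau : R), tau < M ->
    exists2 good : pred I,
      forall i, good i -> (tau%:E < rounds O eps A (f i))%E &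
      \sum_i (~~ good i)%:R < #|I|%:R * gamma) ->
  (M%:E <= compl_HP F X O K eps gamma)%E.
Proof.
move=> cF Ff H.
have I0 : 0 < #|I|%:R :> R by rewrite ltr0n; apply/card_gt0P; exists i0.
pose P : probability (function_space (R := R) (d := d)) R :=
  uniform_on (R := R) i0 (f : I -> function_space (R := R) (d := d)).
apply: le_ereal_sup_tmp; eexists; first by exists P => //; exact: mu_ext_uniform_on.
apply: le_ereal_inf_tmp => _ [A _ <-].
apply: le_ereal_inf_tmp => _ [tau /= gtau <-].
rewrite lee_fin leNgt; apply/negP => /(H A)[good good_gt bad_lt].
(* The success event consists of convex functions, so its outer probability is at most the share of
   indices in it, and none of these is good. *)
move: gtau; apply/negP; rewrite -ltNge.
apply: le_lt_trans (mu_ext_uniform_on_convex i0 _ _) _.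
- by move=> i; exact: cF.
- by move=> g [Fg _]; exact: cF.
rewrite lte_fin ltr_pdivrMr // mulrC; apply: le_lt_trans bad_lt.
apply: ler_sum => i _; rewrite ler_nat; case: (boolP (good i)) => [gi|]; last first.
  by case: (_ \in _).
by rewrite memNset // => -[_ /=]; apply/negP; rewrite -ltNge good_gt.
Qed.

Lemma rounds_ge1 {R : realType} {d K : nat} (X : set 'rV[R]_d) (Ans : Type)
    (O : ('rV[R]_d -> R) -> 'rV[R]_d -> Ans) (eps : R)
    (A : parallel_algorithm X Ans K) (f : 'rV[R]_d -> R) :
  (1 <= rounds O eps A f)%E.
Proof.
apply: le_ereal_inf_tmp => _ [t _ <-].
by rewrite -[X in (X <= _)%E]/(1%:R%:E) lee_fin ler_nat.
Qed.

(** * Choice of the constants *)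

Section constants.
Context {R : realType}.
Variables (d K n : nat) (eps gamma M : R).
Local Notation N := n.+1.
Local Notation L := (ln (M * K%:R / gamma)).
Local Notation a := (4 * Num.sqrt L / Num.sqrt d%:R).

Lemma ln_ratio_gt0 : (1 <= K)%N -> 0 < gamma < 1 -> 1 < M -> 0 < L.
Proof.
move=> K1 /andP[g0 g1] M1; rewrite ln_gt0 // ltr_pdivlMr // mul1r.
apply: (lt_trans g1); apply: (lt_le_trans M1).
by rewrite ler_peMr ?ler1n // ltW // (lt_trans ltr01).
Qed.

(** With [x = M * K%:R / gamma] the exponential is [x ^- 4], and
    [gamma * x ^+ 4 = M * K%:R * x ^+ 3] exceeds [N ^ 4 * K], which bounds the number of events. *)
Lemma union_bound_lt : (1 <= d)%N -> (1 <= K)%N -> 0 < gamma < 1 -> N%:R < M ->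
  (N * N * K + N * n)%:R * expR (- (a ^+ 2 * d%:R / 4)) < gamma.
Proof.
move=> d1 K1 g01 NM; have /andP[g0 g1] := g01.
have N1 : 1 <= N%:R :> R by rewrite ler1n.
have M1 : 1 < M by exact: le_lt_trans NM.
have K1R : 1 <= K%:R :> R by rewrite ler1n.
have L0 := ln_ratio_gt0 K1 g01 M1.
have dR : 0 < d%:R :> R by rewrite ltr0n.
set x := M * K%:R / gamma in L0 *.
have x0 : 0 < x by rewrite divr_gt0 // mulr_gt0 //; lra.
have -> : a ^+ 2 * d%:R / 4 = ln x *+ 4.
  rewrite !exprMn exprVn !sqr_sqrtr ?(ltW L0) ?(ltW dR) // -mulr_natr.
  by field; rewrite gt_eqF.
rewrite expRN -[ln x *+ 4]mulr_natl expRM_natl lnK ?posrE //.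
rewrite ltr_pdivrMr ?exprn_gt0 //.
have MKx : M * K%:R = gamma * x by rewrite /x; field; rewrite gt_eqF.
have xN : N%:R <= x.
  have : M * 1 <= M * K%:R by rewrite ler_pM2l //; lra.
  have : gamma * x <= 1 * x by rewrite ler_pM2r // ltW.
  lra.
rewrite exprS mulrA -MKx.
apply: (@le_lt_trans _ _ (N%:R * K%:R * N%:R ^+ 3)).
  rewrite -natrX -!natrM ler_nat; nia.
apply: (@lt_le_trans _ _ (M * K%:R * N%:R ^+ 3)).
  by rewrite ltr_pM2r ?exprn_gt0 ?ltr0n // ltr_pM2r // ltr0n.
by rewrite ler_pM2l ?mulr_gt0 ?lerXn2r ?nnegrE //; lra.
Qed.

(** The second term of the minimum gives [M * a <= eps / 8]. The first gives
    [200 * N * eps ^+ 2 < 1], hence [9 * eps * sqrt N < 1] as [81 < 200], which is the room needed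
    for [9 / 8 * eps]. *)
Lemma threshold_bounds : (1 <= d)%N -> (1 <= K)%N -> 0 < eps < 1 / 2 ->
  0 < gamma < 1 -> N%:R < M -> M = rounds_bound d K eps gamma M ->
  N%:R * a <= 1 / 2 /\ eps + N%:R * a < 1 / (8 * Num.sqrt N%:R).
Proof.
move=> d1 K1 /andP[e0 e1] g01 NM.
have N1 : 1 <= N%:R :> R by rewrite ler1n.
have M1 : 1 < M by exact: le_lt_trans NM.
have L0 := ln_ratio_gt0 K1 g01 M1.
rewrite /rounds_bound L0 => ME.
have sd : 0 < Num.sqrt d%:R :> R by rewrite sqrtr_gt0 ltr0n.
have sL : 0 < Num.sqrt L by rewrite sqrtr_gt0.
have sN : 0 < Num.sqrt N%:R :> R by rewrite sqrtr_gt0 ltr0n.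
have a0 : 0 < a by rewrite divr_gt0 // mulr_gt0.
have : M <= 1 / (200 * eps ^+ 2) by rewrite ME ge_min lexx.
rewrite ler_pdivlMr ?mulr_gt0 ?exprn_gt0 // => Meps.
have Ma : M * a <= eps / 8.
  apply: (@le_trans _ _ (eps * Num.sqrt d%:R / (32 * Num.sqrt L) * a)).
    by rewrite ler_pM2r // [X in X <= _]ME ge_min lexx orbT.
  rewrite le_eqVlt; apply/orP; left; apply/eqP.
  by field; apply/andP; split; rewrite gt_eqF.
have Na : N%:R * a < M * a by rewrite ltr_pM2r.
split; first by lra.
apply: (@lt_trans _ _ (9 / 8 * eps)); first by lra.
rewrite ltr_pdivlMr ?mulr_gt0 //.
have : (9 * eps * Num.sqrt N%:R) ^+ 2 < 1 ^+ 2.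
  rewrite exprMn sqr_sqrtr ?ler0n // expr1n.
  have : N%:R * (200 * eps ^+ 2) < M * (200 * eps ^+ 2).
    by rewrite ltr_pM2r // mulr_gt0 // exprn_gt0.
  have : 0 <= N%:R * eps ^+ 2 by rewrite mulr_ge0 // sqr_ge0.
  have -> : (9 * eps) ^+ 2 * N%:R = 81 * (N%:R * eps ^+ 2) by ring.
  lra.
by rewrite ltr_pXn2r ?nnegrE ?mulr_ge0 ?(ltW e0) ?(ltW sN) //; lra.
Qed.

End constants.

Theorem theorem3p5 (R : realType) (poly : {poly R}) (d K : nat)
    (eps gamma p M : R) (Ans : Type)
    (O : ('rV[R]_d -> R) -> 'rV[R]_d -> Ans)
    (F := nonsmooth_class p 1 : set ('rV[R]_d -> R))
    (X := euclidean_ball (1 / d%:R `^ (1 / p - 1 / 2)) : set 'rV[R]_d) :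
  (1 <= d)%N -> (1 <= K)%N ->
  0 < eps < 1 / 2 ->
  0 < poly.[d%:R] -> 1 / poly.[d%:R] < gamma < 1 ->
  1 <= p <= 2 ->
  local_oracle F X O ->
  M = rounds_bound d K eps gamma M ->
  (M%:E <= compl_HP F X O K eps gamma)%E.
Proof.
move=> d1 K1 eps01 poly0 /andP[gpoly g1] /andP[p1 _] local_O ME.
have g0 : 0 < gamma by apply: lt_trans gpoly; rewrite divr_gt0.
have dR : 0 < d%:R :> R by rewrite ltr0n.
pose b : R := d%:R `^ (1 / p - 1).
have b0 : 0 < b by exact: powR_gt0.
have FE a n z t : F (@hard R d n b a z t) by exact: hard_nonsmooth.
have cF g : F g -> convex_function [set: convex_lmodType 'rV[R]_d] g by case.
pose z0 n : {ffun 'I_n.+1 -> {ffun 'I_d -> bool}} := [ffun=> [ffun=> true]].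
(* For [M <= 1] no positive integer lies below [M]; as rounds are numbered from 1, every instance is
   good. *)
have [M1|M1] := leP M 1.
  apply: (compl_HP_ge (z0 0) cF (fun z => FE 1 0 z 0)) => A tau tauM.
  exists xpredT => [z _|].
    by apply: lt_le_trans (rounds_ge1 _ _ _ _); rewrite lte_fin (lt_le_trans tauM).
  rewrite big1 // mulr_gt0 // ltr0n; apply/card_gt0P; by exists (z0 0).
(* [N = n.+1] is the largest integer strictly below [M], so that [tau < M] implies [tau < N.+1]. *)
have [n [NM MN]] : exists n, (n.+1)%:R < M /\ M <= n.+2%:R.
  have exM : exists m : nat, M <= m%:R.
    by exists (Num.truncn M).+1; exact/ltW/truncnS_gt.
  case: (ex_minnP exM) => -[|[|n]] Mm minm; [lra|lra|exists n; split => //].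
  by rewrite ltNge; apply/negP => /minm; rewrite ltnn.
pose a : R := 4 * Num.sqrt (ln (M * K%:R / gamma)) / Num.sqrt d%:R.
have g01 : 0 < gamma < 1 by rewrite g0.
have [Na lt_eps] := threshold_bounds d1 K1 eps01 g01 NM ME.
have a0 : 0 < a.
  by rewrite divr_gt0 ?mulr_gt0 ?sqrtr_gt0 // ln_ratio_gt0.
set rho := 1 / _ in X local_O *.
have rho0 : 0 < rho by rewrite divr_gt0 // powR_gt0.
have brho : b * rho * Num.sqrt d%:R = 1.
  rewrite /rho /b [1 / _ `^ _]div1r -powRN -powR12_sqrt ?ltW //.
  rewrite -!powRD ?(gt_eqF dR) ?implybT //.
  rewrite (_ : _ + _ = 0) ?powRr0 //; field; rewrite gt_eqF //; lra.
apply: (compl_HP_ge (z0 n) cF (fun z => FE a n z n)) => A tau tauM.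
exists (good b a O A) => [z gz|].
  apply: (rounds_gt d1 b0 a0 rho0 brho _ local_O gz) => //.
  exact: lt_le_trans MN.
apply: (le_lt_trans (bad_tail O A d1 b0 a0 rho0 brho)).
rewrite ltr_pM2l; first exact: union_bound_lt.
rewrite ltr0n; apply/card_gt0P; by exists (z0 n).
Qed.
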